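(* Let $M=3$, let $N$ be a positive integer, and for $\Phi=\{\varphi_n\}_{n=1}^N\subseteq\mathbb{C}^M$ let $\mathcal{A}\colon\mathbb{C}^M/\mathbb{T}\rightarrow\mathbb{R}^N$ be defined by $(\mathcal{A}(x))(n):=|\langle x,\varphi_n\rangle|^2$. Then: (a) If $N<4M-4=8$, then $\mathcal{A}$ is not injective (for any $\Phi$). (b) If $N\geq 4M-4=8$, then $\mathcal{A}$ is injective for generic $\Phi$.
   Context: $\mathbb{T}=\{c\in\mathbb{C}:|c|=1\}$. $\mathbb{C}^M/\mathbb{T}$ denotes $\mathbb{C}^M$ with $x$ and $y$ identified whenever $y=cx$ for some $c\in\mathbb{T}$; injectivity of $\mathcal{A}$ means: $\mathcal{A}(x)=\mathcal{A}(y)$ implies $y=cx$ for some $c\in\mathbb{T}$. The inner product on $\mathbb{C}^M$ is $\langle x,\varphi\rangle=\varphi^*x$. A real algebraic variety in $\mathbb{R}^n$ is the set of common zeros of a finite set of polynomials with real coefficients; the Zariski topology on $\mathbb{R}^n$ has exactly these sets as closed sets. View $\Phi$ as an element of $\mathbb{R}^{2MN}$ via the real and imaginary parts of the entries of the $\varphi_n$. A property holds for generic $\Phi$ if there is a nonempty Zariski-open subset of $\mathbb{R}^{2MN}$ such that the property holds for every $\Phi$ in it. *)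

(* Defs.v *)
From HB Require Import structures.
From mathcomp Require Import all_boot all_order all_algebra.
From mathcomp Require Import complex mpoly.
From mathcomp Require Import boolp classical_sets reals.

Set Implicit Arguments.
Unset Strict Implicit.
Unset Printing Implicit Defensive.

Import Order.TTheory GRing.Theory Num.Theory.
Local Open Scope classical_set_scope.
Local Open Scope ring_scope.
Local Open Scope complex_scope.

Definition inner (R : realType) (M : nat) (x phi : 'cV[R[i]]_M) : R[i] :=
  ((map_mx (@conjc R) phi)^T *m x) 0 0.

(* The family phi_1, ..., phi_N is given by the columns of [Phi]. The modulus
   [Normc.normc] takes values in [R], unlike [`|_|] on [R[i]]. *)
Definition intensity (R : realType) (M N : nat) (Phi : 'M[R[i]]_(M, N))
    (x : 'cV[R[i]]_M) : 'rV[R]_N :=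
  \row_(n < N) Normc.normc (inner x (col n Phi)) ^+ 2.

Definition eq_mod_phase (R : realType) (M : nat) (x y : 'cV[R[i]]_M) : Prop :=
  exists2 c : R[i], Normc.normc c = 1 & y = c *: x.

(* Injectivity of the map induced by [A] on C^M / T. *)
Definition injective_mod_phase (R : realType) (M N : nat)
    (A : 'cV[R[i]]_M -> 'rV[R]_N) : Prop :=
  forall x y, A x = A y -> eq_mod_phase x y.

Definition common_zeros (R : realType) (d : nat) (ps : seq {mpoly R[d]}) :
    set 'rV[R]_d :=
  [set v | forall p, p \in ps -> p.@[fun i => v 0 i] = 0].

Definition zariski_closed (R : realType) (d : nat) (Z : set 'rV[R]_d) : Prop :=
  exists ps : seq {mpoly R[d]}, Z = common_zeros ps.

Definition zariski_open (R : realType) (d : nat) (U : set 'rV[R]_d) : Prop :=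
  zariski_closed (~` U).

(* Identification of C^(M x N) with R^(2MN): first the real parts of all the
   entries, then the imaginary parts. *)
Definition real_coords (R : realType) (M N : nat) (Phi : 'M[R[i]]_(M, N)) :
    'rV[R]_(M * N + M * N) :=
  row_mx (mxvec (map_mx (@complex.Re R) Phi))
         (mxvec (map_mx (@complex.Im R) Phi)).

Definition generically (R : realType) (M N : nat)
    (P : 'M[R[i]]_(M, N) -> Prop) : Prop :=
  exists U : set 'rV[R]_(M * N + M * N),
    [/\ zariski_open U, U !=set0 & forall Phi, U (real_coords Phi) -> P Phi].

(* Main.v *)
Require Import Defs.
From HB Require Import structures.
From mathcomp Require Import all_boot all_order all_algebra.
From mathcomp Require Import complex reals.
From mathcomp Require Import mpoly ring lra boolp classical_sets.

(** The intensities of [x] depend linearly on the Hermitian matrix [x x^*]: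
    [|<x, phi>|^2 = <x x^*, phi phi^*>].  Hence injectivity fails as soon as
    some nonzero singular Hermitian [H] is orthogonal to all [phi_n phi_n^*]:
    by the spectral theorem [H] is, up to sign, [x x^* - y y^*] or
    [x x^* + y y^*], and then [x] has the same intensities as [y], respectively
    as [0].  Conversely [x x^* - y y^*] is always singular when [M = 3].

    Hermitian 3x3 matrices form a real space of dimension 9.  For [N <= 7] the
    orthogonal complement has dimension at least 2, and as [det] is odd it
    vanishes somewhere on a path from [A] to [-A] avoiding [0].
    For [N >= 8] the complement of the first 8 matrices is generically a line,
    spanned by a vector of cofactors [V]; [det V <> 0] is then a polynomial
    condition on the family, and it suffices to exhibit one family for which it
    holds. *)

Set Implicit Arguments.
Unset Strict Implicit.
Unset Printing Implicit Defensive.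

Import Order.TTheory GRing.Theory Num.Theory.

Section PhaseRetrieval.

Local Open Scope ring_scope.
Local Open Scope complex_scope.

(** * Explicit formulas in dimension three *)

Lemma big_ord3 (T : Type) (idx : T) (op : Monoid.law idx) (F : 'I_3 -> T) :
  \big[op/idx]_(i < 3) F i = op (op (F 0) (F 1)) (F 2%:R).
Proof.
rewrite !big_ord_recr big_ord0 /= Monoid.mul1m.
by congr (op (op (F _) (F _)) (F _)); apply: val_inj.
Qed.

Lemma ord3P (P : 'I_3 -> Prop) : P 0 -> P 1 -> P 2%:R -> forall i, P i.
Proof.
move=> P0 P1 P2 [[|[|[|i]]] lti] //.
- by rewrite (_ : Ordinal lti = 0) //; apply: val_inj.
- by rewrite (_ : Ordinal lti = 1) //; apply: val_inj.
- by rewrite (_ : Ordinal lti = 2%:R) //; apply: val_inj.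
Qed.

Lemma det_mx33 (T : comNzRingType) (A : 'M[T]_3) :
  \det A = A 0 0 * (A 1 1 * A 2%:R 2%:R - A 1 2%:R * A 2%:R 1)
         - A 0 1 * (A 1 0 * A 2%:R 2%:R - A 1 2%:R * A 2%:R 0)
         + A 0 2%:R * (A 1 0 * A 2%:R 1 - A 1 1 * A 2%:R 0).
Proof.
(* Indexing entries by naturals lets the shifted indices of the minors reduce by computation. *)
have [f fE] : exists f : nat -> nat -> T, forall i j, A i j = f i j.
  by exists (fun a b => A (inord a) (inord b)) => i j; rewrite !inord_val.
rewrite (expand_det_row _ 0) big_ord3 /cofactor.
rewrite !(expand_det_row _ (0 : 'I_2)) !big_ord_recl !big_ord0 /cofactor.
by rewrite !det_mx11 !mxE !fE /= /bump /=; ring.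
Qed.

(** * Real encoding of Hermitian matrices *)

Definition frob (T : comNzRingType) n (S S' : 'M[T]_n) : T :=
  \sum_i \sum_j S i j * S' i j.

(* A Hermitian matrix [H] is encoded by the real matrix [Re H + Im H]; this is
   a linear isometry for the Frobenius inner products.  [gram p q] encodes
   [x x^*] for [x = p + 'i q]. *)
Definition gram (T : comNzRingType) n (p q : 'cV[T]_n) : 'M[T]_n :=
  \matrix_(i, j) (p i 0 * p j 0 + q i 0 * q j 0 - p i 0 * q j 0 + q i 0 * p j 0).

(* The determinant of [re + 'i im], twice the Hermitian matrix encoded by [S]. *)
Definition hdet (T : comNzRingType) (S : 'M[T]_3) : T :=
  let re i j := S i j + S j i in let im i j := S i j - S j i in
  re 0 0 * re 1 1 * re 2%:R 2%:R
  + 2%:R * (re 0 1 * (re 1 2%:R * re 0 2%:R + im 1 2%:R * im 0 2%:R)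
          - im 0 1 * (im 1 2%:R * re 0 2%:R - re 1 2%:R * im 0 2%:R))
  - re 0 0 * (re 1 2%:R ^+ 2 + im 1 2%:R ^+ 2)
  - re 1 1 * (re 0 2%:R ^+ 2 + im 0 2%:R ^+ 2)
  - re 2%:R 2%:R * (re 0 1 ^+ 2 + im 0 1 ^+ 2).

Lemma hdet_map (T T' : comNzRingType) (f : {rmorphism T -> T'}) (S : 'M[T]_3) :
  hdet (map_mx f S) = f (hdet S).
Proof.
by rewrite /hdet !mxE !(rmorphB, rmorphD, rmorphM, rmorphXn, rmorph1).
Qed.

Lemma hdetZ (T : comNzRingType) a (S : 'M[T]_3) : hdet (a *: S) = a ^+ 3 * hdet S.
Proof. by rewrite /hdet !mxE; ring. Qed.

Lemma hdetN (T : comNzRingType) (S : 'M[T]_3) : hdet (- S) = - hdet S.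
Proof. by rewrite /hdet !mxE; ring. Qed.

(** The encoded matrix [x x^* - y y^*] has rank at most 2. *)
Lemma hdet_gramB (T : comNzRingType) (p q r s : 'cV[T]_3) :
  hdet (gram p q - gram r s) = 0.
Proof. by rewrite /hdet !mxE; ring. Qed.

(** * Rank-one matrices and the spectral decomposition *)

Section Outer.
Variable R : realType.
Implicit Types (x y : 'cV[R[i]]_3) (S A B : 'M[R]_3).

Definition outer x : 'M[R]_3 :=
  gram (map_mx (@complex.Re R) x) (map_mx (@complex.Im R) x).

Lemma outerE x i j :
  outer x i j = complex.Re (x i 0 * (x j 0)^*) + complex.Im (x i 0 * (x j 0)^*).
Proof.
by rewrite !mxE; case: (x i 0) => a b; case: (x j 0) => c d /=; ring.
Qed.

Lemma sqr_normc_ReIm (z : R[i]) :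
  Normc.normc z ^+ 2 = complex.Re z ^+ 2 + complex.Im z ^+ 2.
Proof.
by case: z => a b; rewrite /Normc.normc sqr_sqrtr // addr_ge0 ?sqr_ge0.
Qed.

Lemma intensityE N (Phi : 'M[R[i]]_(3, N)) x n :
  intensity Phi x 0 n = frob (outer x) (outer (col n Phi)).
Proof.
rewrite mxE sqr_normc_ReIm /frob /inner mxE !big_ord3 !mxE /=.
case: (x 0 0) (x 1 0) (x 2%:R 0) => a0 b0 [a1 b1] [a2 b2].
case: (Phi 0 n) (Phi 1 n) (Phi 2%:R n) => c0 d0 [c1 d1] [c2 d2] /=.
ring.
Qed.

Lemma outerZ c x : Normc.normc c = 1 -> outer (c *: x) = outer x.
Proof.
move=> c1; have : Normc.normc c ^+ 2 = 1 by rewrite c1 expr1n.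
rewrite sqr_normc_ReIm; case: c {c1} => a b /= ab1; apply/matrixP => i j.
rewrite !outerE !mxE; case: (x i 0) => c d; case: (x j 0) => e f /=.
rewrite -[RHS]mul1r -ab1; ring.
Qed.

Lemma outer_realZ (a : R) x : outer (a%:C *: x) = a ^+ 2 *: outer x.
Proof.
apply/matrixP => i j; rewrite [RHS]mxE !outerE !mxE.
case: (x i 0) => c d; case: (x j 0) => e f /=; ring.
Qed.

Lemma outer0 : outer 0 = 0.
Proof. by apply/matrixP => i j; rewrite !mxE /=; ring. Qed.

Lemma outer_inj x y : outer x = outer y -> eq_mod_phase x y.
Proof.
move=> exy.
have xy i j : x i 0 * (x j 0)^* = y i 0 * (y j 0)^*.
  (* The entries [(i, j)] and [(j, i)] are the sum and the difference of the real and imaginary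
     parts of one complex number. *)
  have /matrixP e := exy; move: (e i j) (e j i); rewrite !outerE.
  case: (x i 0) (x j 0) (y i 0) (y j 0) => a b [c d] [a' b'] [c' d'] /= e1 e2.
  by apply/eqP; rewrite eq_complex /=; apply/andP; split; apply/eqP; lra.
have [x0|/eqP/matrixP] := eqVneq x 0.
  exists 1; first by rewrite /Normc.normc /= expr1n expr0n addr0 sqrtr1.
  apply/matrixP => i j; rewrite ord1 x0 scaler0 mxE; apply/eqP.
  have := xy i i; rewrite x0 !mxE mul0r => /esym/eqP.
  by rewrite mulf_eq0 conjc_eq0 orbb.
move=> /existsNP[j /existsNP[k]]; rewrite ord1 mxE => /eqP xj0.
have yj0 : y j 0 != 0.
  have := xy j j; apply: contra_eq_neq => ->; rewrite mul0r.
  by rewrite mulf_neq0 ?conjc_eq0.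
(* The phase is read off at a nonzero coordinate; the diagonal entry [(j, j)] gives it modulus 1. *)
exists (y j 0 / x j 0).
  have xyj : Normc.normc (x j 0) = Normc.normc (y j 0).
    have := xy j j; case: (x j 0) (y j 0) => a b [c d] /= [e _].
    by congr Num.sqrt; move: e; lra.
  rewrite Normc.normcM Normc.normcV -xyj mulfV //.
  by apply: contra_neq xj0 => /Normc.eq0_normc.
apply/matrixP => i l; rewrite ord1 mxE {l}.
apply: (mulIf (x := (y j 0)^*)); first by rewrite conjc_eq0.
rewrite -xy [RHS](_ : _ = y j 0 * (y j 0)^* * x i 0 / x j 0); last by ring.
by rewrite -xy; field.
Qed.

(** The square roots of [|d|] and [|e|] are absorbed into the vectors, so only the signs remain. *)
Lemma outer_sum_signs (d e : R) (x y : 'cV[R[i]]_3) : exists z w,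
  let S := d *: outer x + e *: outer y in
  [\/ S = outer z - outer w, S = outer z + outer w | S = - (outer z + outer w)].
Proof.
have pos (c : R) z : 0 <= c -> c *: outer z = outer ((Num.sqrt c)%:C *: z).
  by move=> c0; rewrite outer_realZ sqr_sqrtr.
have neg (c : R) z : c < 0 -> c *: outer z = - outer ((Num.sqrt (- c))%:C *: z).
  by move=> c0; rewrite -pos ?scaleNr ?opprK // oppr_ge0 ltW.
have [d0|d0] := lerP 0 d; have [e0|e0] := lerP 0 e.
- by eexists _, _; rewrite !pos //=; constructor 2.
- by eexists _, _; rewrite pos // neg //=; constructor 1.
- by eexists _, _; rewrite neg // pos //= addrC; constructor 1.
- by eexists _, _; rewrite !neg //= -opprD; constructor 3.
Qed.

(** A zero determinant makes one of the three eigenvalues vanish, so the spectral sum has only two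
    terms left. *)
Lemma herm_decomposition S : hdet S = 0 ->
  exists x y,
  [\/ S = outer x - outer y, S = outer x + outer y | S = - (outer x + outer y)].
Proof.
move=> S0.
pose H : 'M[R[i]]_3 := \matrix_(i, j) ((S i j + S j i) +i* (S i j - S j i)).
have herm : H \is hermitianmx 3 false Num.conj.
  apply/is_hermitianmxP; rewrite expr0 scale1r; apply/matrixP => i j.
  rewrite !mxE; apply/eqP; rewrite eq_complex /= addrC eqxx /=.
  by rewrite opprB.
have detH : \det H = 0.
  have -> : \det H = (hdet S)%:C; last by rewrite S0.
  by rewrite det_mx33 !mxE /hdet; apply/eqP; rewrite eq_complex /=;
    apply/andP; split; apply/eqP; ring.
have /orthomx_spectralP := hermitian_normalmx herm.
have /mxOverP dreal := hermitian_spectral_diag_real herm.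
have uP := spectral_unitarymx H.
rewrite invmx_unitary ?spectral_unitarymx //.
move: (spectralmx H) (spectral_diag H) uP dreal => P d uP dreal eH.
have {detH} : d 0 0 * d 0 1 * d 0 2%:R = 0.
  rewrite -[RHS]detH eH !det_mulmx [RHS]mulrAC -det_mulmx -invmx_unitary //.
  by rewrite mulVmx ?unitarymx_unit // det1 mul1r det_diag big_ord3.
(* From [H = P^* D P], the eigenvectors are the columns of [P^*]; eigenvalues are halved because [H]
   is twice the matrix encoded by [S]. *)
pose x k : 'cV[R[i]]_3 := \col_i (P k i)^*.
pose e k := complex.Re (d 0 k) / 2%:R.
have eS : S = \sum_k e k *: outer (x k).
  apply/matrixP => i j; apply: (mulIf (x := 2%:R)); first by rewrite pnatr_eq0.
  transitivity (complex.Re (H i j) + complex.Im (H i j)).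
    by rewrite mxE /=; ring.
  rewrite eH mul_mx_diag mxE summxE mulr_suml !raddf_sum -big_split /=.
  apply: eq_bigr => k _; rewrite [in RHS]mxE outerE !mxE /e.
  rewrite -(RRe_real (dreal 0 k)); case: (d 0 k) => r ?.
  by case: (P k i) (P k j) => a b [a' b'] /=; field.
have dE k : d 0 k = (e k * 2%:R)%:C.
  by rewrite divfK ?pnatr_eq0 // RRe_real.
move: eS; rewrite big_ord3 /= => eS /eqP; rewrite !mulf_eq0 -!orbA => /or3P[] /eqP;
  rewrite dE => -[] /eqP; rewrite mulf_eq0 pnatr_eq0 orbF => /eqP h; rewrite h in eS.
- by rewrite eS scale0r add0r; apply: outer_sum_signs.
- by rewrite eS scale0r addr0; apply: outer_sum_signs.
- by rewrite eS scale0r addr0; apply: outer_sum_signs.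
Qed.

End Outer.

(** * Frobenius product and kernels *)

Lemma frob_mxvec (T : comNzRingType) n (S S' : 'M[T]_n) :
  frob S S' = \sum_k mxvec S 0 k * mxvec S' 0 k.
Proof.
rewrite /frob pair_big (reindex _ (curry_mxvec_bij n n)) /=.
by apply: eq_bigr => -[i j] _; rewrite !mxvecE.
Qed.

Lemma frob_linear (T : comNzRingType) n (a b : T) (S S' U : 'M[T]_n) :
  frob (a *: S + b *: S') U = a * frob S U + b * frob S' U.
Proof.
rewrite /frob !mulr_sumr -big_split; apply: eq_bigr => i _ /=.
rewrite !mulr_sumr -big_split; apply: eq_bigr => j _ /=.
by rewrite !mxE; ring.
Qed.

Lemma frob_eq0 (R : realDomainType) n (S : 'M[R]_n) : frob S S = 0 -> S = 0.
Proof.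
move=> S0; apply/matrixP => i j; rewrite mxE; apply/eqP; rewrite -sqrf_eq0 expr2.
move/psumr_eq0P: S0 => /(_ _ i isT) S0; apply/eqP.
have /psumr_eq0P -> // : \sum_j S i j * S i j = 0.
  by apply: S0 => k _; apply: sumr_ge0 => l _; rewrite -expr2 sqr_ge0.
by move=> k _; rewrite -expr2 sqr_ge0.
Qed.

Lemma exists_kernel (F : fieldType) m n (L : 'M[F]_(m, n)) : (n < m)%N ->
  exists2 v : 'rV_m, v != 0 & v *m L = 0.
Proof.
move=> ltnm; suff /rowV0Pn[v /sub_kermxP vL v0] : kermx L != 0 by exists v.
by rewrite -mxrank_eq0 mxrank_ker subn_eq0 -ltnNge (leq_ltn_trans (rank_leq_col L)).
Qed.

(** * Singular matrices in a kernel of dimension at least two *)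

Section Pencil.
Variable R : realType.
Implicit Types S A B : 'M[R]_3.

(** The path runs from [-A] at [t = -1] to [A] at [t = 1], where [hdet] takes opposite values; the
    intermediate value theorem for polynomials applies. *)
Lemma pencil_root A B :
  exists t, hdet (t *: A + (1 - t ^+ 2) *: B) = 0.
Proof.
pose p : {poly R} := hdet ('X *: map_mx polyC A + (1 - 'X ^+ 2) *: map_mx polyC B).
have pE t : p.[t] = hdet (t *: A + (1 - t ^+ 2) *: B).
  rewrite -[LHS]/(horner_eval t p) -hdet_map; congr hdet.
  apply/matrixP => i j; rewrite !mxE /= /horner_eval.
  by rewrite !(hornerD, hornerN, hornerM, hornerC, hornerX).
have p1 : p.[1] = hdet A by rewrite pE expr1n subrr scale0r addr0 scale1r.
have pN1 : p.[-1] = - hdet A.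
  by rewrite pE sqrrN expr1n subrr scale0r addr0 scaleN1r hdetN.
have le11 : -1 <= 1 :> R by lra.
have [A0|A0] := lerP 0 (hdet A).
  have [|t _ /rootP pt] := poly_ivt (p := p) le11; last by exists t; rewrite -pE.
  by rewrite p1 pN1; lra.
have [|t _ /rootP pt] := poly_ivt (p := - p) le11.
  by rewrite !hornerN p1 pN1; lra.
by exists t; rewrite -pE; apply/eqP; rewrite -oppr_eq0 -hornerN pt.
Qed.

Lemma singular_in_kernel N (G : 'I_N -> 'M[R]_3) : (N < 8)%N ->
  exists2 S, S != 0 & hdet S = 0 /\ forall n, frob S (G n) = 0.
Proof.
move=> ltN8; pose L : 'M[R]_(3 * 3, N) := \matrix_(k, n) mxvec (G n) 0 k.
have LE (v : 'rV_(3 * 3)) : v *m L = 0 -> forall n, frob (vec_mx v) (G n) = 0.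
  move=> vL n; transitivity ((v *m L) 0 n); last by rewrite vL mxE.
  by rewrite frob_mxvec vec_mxK mxE; apply: eq_bigr => k _; rewrite mxE.
have [|a a0 aL] := exists_kernel L; first exact: leq_trans ltN8 _.
(* The extra column makes [b] orthogonal to [a]; a kernel remains since [N + 1 < 9]. *)
have [|b b0] := exists_kernel (row_mx L a^T).
  by rewrite addn1; apply: leq_ltn_trans ltN8 _.
rewrite mul_mx_row -[RHS](row_mx0) => /eq_row_mx[bL ba].
have [t ht] := pencil_root (vec_mx a) (vec_mx b).
exists (t *: vec_mx a + (1 - t ^+ 2) *: vec_mx b); last first.
  by split=> // n; rewrite frob_linear !LE // !mulr0 addr0.
have fba : frob (vec_mx b) (vec_mx a) = 0.
  transitivity ((b *m a^T) 0 0); last by rewrite ba mxE.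
  by rewrite frob_mxvec !vec_mxK mxE; apply: eq_bigr => k _; rewrite mxE.
(* If the combination vanished, pairing it with [a] would give [t = 0], and then [b = 0]. *)
apply/eqP => e0; have := frob_linear t (1 - t ^+ 2) (vec_mx a) (vec_mx b) (vec_mx a).
rewrite e0 fba mulr0 addr0 {1}/frob big1; last first.
  by move=> i _; rewrite big1 // => j _; rewrite mxE mul0r.
move=> /esym/eqP; rewrite mulf_eq0 => /orP[/eqP t0|/eqP/frob_eq0].
  move: e0; rewrite t0 scale0r add0r expr0n subr0 scale1r => /(congr1 mxvec).
  by rewrite vec_mxK linear0 => /eqP; rewrite (negPf b0).
by move=> /(congr1 mxvec); rewrite vec_mxK linear0 => /eqP; rewrite (negPf a0).
Qed.
End Pencil.

(** * Injectivity in terms of singular matrices *)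

Section Injectivity.
Variables (R : realType) (N : nat) (Phi : 'M[R[i]]_(3, N)).
Implicit Type S : 'M[R]_3.

Lemma singular_not_injective S : S != 0 -> hdet S = 0 ->
  (forall n, frob S (outer (col n Phi)) = 0) ->
  ~ injective_mod_phase (intensity Phi).
Proof.
move=> S0 h0 kerS inj.
have I0 z n : 0 <= intensity Phi z 0 n by rewrite mxE sqr_ge0.
have II0 n : intensity Phi 0 0 n = 0.
  rewrite intensityE outer0 /frob big1 // => i _.
  by rewrite big1 // => j _; rewrite mxE mul0r.
(* Injectivity is applied to the pair [0], [z]; this settles the two cases where the signs agree. *)
have eq0 z : intensity Phi z = 0 -> z = 0.
  move=> Iz; have [|c _ ->] := inj 0 z; last exact: scaler0.
  by rewrite Iz; apply/rowP => n; rewrite II0 mxE.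
have sum0 z w : (forall n, intensity Phi z 0 n + intensity Phi w 0 n = 0) ->
    z = 0 /\ w = 0.
  by move=> zw; split; apply: eq0; apply/rowP => n; rewrite [RHS]mxE;
    move: (zw n) (I0 z n) (I0 w n); lra.
have fI d e x y : S = d *: outer x + e *: outer y -> forall n,
  d * intensity Phi x 0 n + e * intensity Phi y 0 n = 0.
  by move=> defS n; rewrite -(kerS n) defS frob_linear !intensityE.
have diff x y : S = outer x - outer y -> False.
  rewrite -[outer x]scale1r -[- _]scaleN1r => defS.
  have [|c c1 yx] := inj x y.
    by apply/rowP => n; move: (fI _ _ _ _ defS n); lra.
  by move: S0; rewrite defS yx outerZ // scale1r scaleN1r subrr eqxx.
case/herm_decomposition: h0 => x [y [] defS].
- exact: diff defS.
- move: S0; rewrite defS.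
  have [n|-> ->] := sum0 x y; last by rewrite outer0 addr0 eqxx.
  have := fI 1 1 x y; rewrite !scale1r => /(_ defS n); lra.
- move: S0; rewrite defS.
  have [n|-> ->] := sum0 x y; last by rewrite outer0 addr0 oppr0 eqxx.
  have := fI (-1) (-1) x y; rewrite !scaleN1r -opprD => /(_ defS n); lra.
Qed.

Lemma injective_of_kernel :
  (forall S, (forall n, frob S (outer (col n Phi)) = 0) -> hdet S = 0 -> S = 0) ->
  injective_mod_phase (intensity Phi).
Proof.
move=> ker x y exy; apply: outer_inj; apply/eqP; rewrite -subr_eq0; apply/eqP.
apply: ker; last exact: hdet_gramB.
move=> n; rewrite -[outer x]scale1r -[- _]scaleN1r frob_linear -!intensityE exy.
by rewrite mul1r mulN1r subrr.
Qed.
End Injectivity.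

(** * A polynomial certificate of injectivity *)

Section Certificate.
Variables (T : comNzRingType) (N : nat) (f : 'I_8 -> 'I_N).

(* The extra last row makes the system square, so that its kernel line can be
   read off the last column of the adjugate. *)
Definition gram_system (P Q : 'M[T]_(3, N)) : 'M[T]_(3 * 3) :=
  \matrix_(k, l) if unlift (ord_max : 'I_9) k is Some k'
    then mxvec (gram (col (f k') P) (col (f k') Q)) 0 l else (l == mxvec_index 0 0)%:R.

Definition kernel_candidate (P Q : 'M[T]_(3, N)) : 'M[T]_3 :=
  vec_mx (col ord_max (\adj (gram_system P Q)))^T.

(** If the first factor is nonzero, the kernel is at most a line; if the second is too, that line
    has no nonzero singular element. *)
Definition certificate (P Q : 'M[T]_(3, N)) : T :=
  \det (gram_system P Q) * hdet (kernel_candidate P Q).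

Lemma gram_system_mul P Q S : gram_system P Q *m (mxvec S)^T =
  \col_k (if unlift (ord_max : 'I_9) k is Some k'
           then frob S (gram (col (f k') P) (col (f k') Q)) else S 0 0).
Proof.
apply/colP => k; rewrite !mxE; case: unliftP => [k'|] ->.
  by rewrite frob_mxvec; apply: eq_bigr => l _; rewrite !mxE liftK mulrC.
rewrite (bigD1 (mxvec_index 0 0)) //= big1 => [|l l0]; rewrite !mxE unlift_none.
  by rewrite eqxx mul1r addr0 mxvecE.
by rewrite (negPf l0) mul0r.
Qed.

(** Cramer's rule: the system sends [S] to [S 0 0] times the last basis vector, and the adjugate is
    applied to both sides. *)
Lemma kernel_candidateP P Q S :
  (forall k, frob S (gram (col (f k) P) (col (f k) Q)) = 0) ->
  \det (gram_system P Q) *: S = S 0 0 *: kernel_candidate P Q.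
Proof.
move=> kerS; have BS : gram_system P Q *m (mxvec S)^T = S 0 0 *: delta_mx ord_max 0.
  rewrite gram_system_mul; apply/colP => k; rewrite !mxE.
  case: unliftP => [k'|] ->; last by rewrite eqxx mulr1.
  by rewrite kerS eq_sym (negPf (neq_lift _ _)) mulr0.
apply: (can_inj mxvecK); apply: trmx_inj; rewrite !linearZ /= vec_mxK trmxK.
rewrite -mul_scalar_mx -mul_adj_mx -mulmxA BS -scalemxAr; congr (_ *: _).
by rewrite -colE.
Qed.
End Certificate.

Lemma certificate_map (T T' : comNzRingType) (g : {rmorphism T -> T'}) N
    (f : 'I_8 -> 'I_N) (P Q : 'M[T]_(3, N)) :
  certificate f (map_mx g P) (map_mx g Q) = g (certificate f P Q).
Proof.
have sys : gram_system f (map_mx g P) (map_mx g Q) = map_mx g (gram_system f P Q).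
  apply/matrixP => k l; rewrite !mxE; case: unliftP => [k' _|_]; last by rewrite rmorph_nat.
  case/mxvec_indexP: l => i j; rewrite !mxvecE !mxE.
  by rewrite !(rmorphB, rmorphD, rmorphM).
rewrite /certificate rmorphM -det_map_mx -sys -hdet_map; congr (_ * hdet _).
by rewrite /kernel_candidate sys -map_mx_adj -map_col map_trmx map_vec_mx.
Qed.

(** Taking [hdet] in Cramer's rule forces [S 0 0 = 0], and then [S = 0]. *)
Lemma certificate_sound (F : fieldType) N (f : 'I_8 -> 'I_N) (P Q : 'M[F]_(3, N)) S :
  certificate f P Q != 0 -> hdet S = 0 ->
  (forall k, frob S (gram (col (f k) P) (col (f k) Q)) = 0) -> S = 0.
Proof.
rewrite mulf_eq0 negb_or => /andP[det0 hdet0] S0 /kernel_candidateP e.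
have /(congr1 (@hdet F)) := e; rewrite !hdetZ S0 mulr0 => /esym/eqP.
rewrite mulf_eq0 (negPf hdet0) orbF expf_eq0 /= => /eqP S00.
move: e; rewrite S00 scale0r => /eqP.
by rewrite scaler_eq0 (negPf det0) => /eqP.
Qed.

Lemma gram_system_det_neq0 (F : fieldType) N (f : 'I_8 -> 'I_N) (P Q : 'M[F]_(3, N)) :
  (forall S, (forall k, frob S (gram (col (f k) P) (col (f k) Q)) = 0) ->
     S 0 0 = 0 -> S = 0) ->
  \det (gram_system f P Q) != 0.
Proof.
move=> ker; apply/negP; rewrite -det_tr => /det0P[v v0 /(congr1 trmx)].
rewrite trmx_mul trmxK trmx0 -{1}[v]vec_mxK gram_system_mul => /colP e.
move: v0; rewrite -[v]vec_mxK (ker (vec_mx v)) ?linear0 ?eqxx // => [k|].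
  by have := e (lift ord_max k); rewrite !mxE liftK.
by have := e ord_max; rewrite !mxE unlift_none.
Qed.

(** One known nonsingular kernel element replaces the computation of the adjugate. *)
Lemma certificate_neq0 (F : fieldType) N (f : 'I_8 -> 'I_N) (P Q : 'M[F]_(3, N)) S :
  \det (gram_system f P Q) != 0 -> hdet S != 0 ->
  (forall k, frob S (gram (col (f k) P) (col (f k) Q)) = 0) ->
  certificate f P Q != 0.
Proof.
move=> det0 S0 /kernel_candidateP e; rewrite mulf_neq0 //.
have /(congr1 (@hdet F)) := e; rewrite !hdetZ => /eqP; apply: contraTneq => ->.
by rewrite mulr0 mulf_neq0 // expf_neq0.
Qed.

(** * An explicit family with nonzero certificate *)

Section Witness.
Variables (R : realType) (N : nat) (leN : (8 <= N)%N).

(* The eight vectors [witness_re + 'i witness_im] are isotropic for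
   [diag (1, 1, -2)], which spans the orthogonal complement of their Gram
   matrices. *)
Definition witness_re : seq (seq R) :=
  [:: [:: 1; 1; 1]; [:: 1; 1; -1]; [:: 1; 1; 0]; [:: 1; -1; 1];
      [:: 1; -1; -1]; [:: 1; -1; 0]; [:: 1; 0; 1]; [:: 0; 1; 1]].

Definition witness_im : seq (seq R) :=
  [:: [:: 0; 0; 0]; [:: 0; 0; 0]; [:: 0; 0; 1]; [:: 0; 0; 0];
      [:: 0; 0; 0]; [:: 0; 0; 1]; [:: 0; 1; 0]; [:: 0; 1; 0]].

(** The defaults of [nth] pad the eight vectors with zero columns up to size [N]. *)
Definition table_mx (tab : seq (seq R)) : 'M[R]_(3, N) :=
  \matrix_(i, n) nth 0 (nth [::] tab n) i.

Lemma witness_certificate :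
  certificate (widen_ord leN) (table_mx witness_re) (table_mx witness_im) != 0.
Proof.
have frobE (S : 'M[R]_3) (k : 'I_8) : frob S (gram
    (col (widen_ord leN k) (table_mx witness_re))
    (col (widen_ord leN k) (table_mx witness_im))) =
  let p := nth [::] witness_re k in let q := nth [::] witness_im k in
  \sum_i \sum_j S i j * (p`_i * p`_j + q`_i * q`_j - p`_i * q`_j + q`_i * p`_j).
  by apply: eq_bigr => i _; apply: eq_bigr => j _; rewrite !mxE.
apply: (@certificate_neq0 _ _ _ _ _ (diag_mx (\row_i [:: 1; 1; - 2%:R]`_i))).
- apply: gram_system_det_neq0 => S kerS S00.
  move: (kerS (@Ordinal 8 0 isT)) (kerS (@Ordinal 8 1 isT)) (kerS (@Ordinal 8 2 isT))
    (kerS (@Ordinal 8 3 isT)) (kerS (@Ordinal 8 4 isT)) (kerS (@Ordinal 8 5 isT))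
    (kerS (@Ordinal 8 6 isT)) (kerS (@Ordinal 8 7 isT)).
  rewrite !frobE /= !big_ord3 /= => *.
  by apply/matrixP; apply: ord3P; apply: ord3P; rewrite [RHS]mxE //; lra.
(* The value is [2 * 2 * (-4) = -16], because of the doubling in [hdet]. *)
- by apply: ltr0_neq0; rewrite /hdet !mxE /=; lra.
- by case=> [[|[|[|[|[|[|[|[|//]]]]]]]] ?]; rewrite frobE /= !big_ord3 !mxE /=; ring.
Qed.
End Witness.

(** * Genericity *)

Section Generic.
Variables (R : realType) (N : nat) (leN : (8 <= N)%N).

(** The family of indeterminates, in the coordinate order of [real_coords]. *)
Definition re_vars : 'M[{mpoly R[3 * N + 3 * N]}]_(3, N) :=
  \matrix_(i, n) 'X_(lshift (3 * N) (mxvec_index i n)).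

Definition im_vars : 'M[{mpoly R[3 * N + 3 * N]}]_(3, N) :=
  \matrix_(i, n) 'X_(rshift (3 * N) (mxvec_index i n)).

Lemma certificate_meval (P Q : 'M[R]_(3, N)) :
  (certificate (widen_ord leN) re_vars im_vars).@[row_mx (mxvec P) (mxvec Q) 0] =
  certificate (widen_ord leN) P Q.
Proof.
set v := row_mx _ _ 0.
have <- := certificate_map (meval v) (widen_ord leN) re_vars im_vars.
have -> : map_mx (meval v) re_vars = P.
  by apply/matrixP => i n; rewrite mxE /= mxE mevalXU /v row_mxEl mxvecE.
have -> // : map_mx (meval v) im_vars = Q.
by apply/matrixP => i n; rewrite mxE /= mxE mevalXU /v row_mxEr mxvecE.
Qed.

Lemma generic_injectivity : generically (fun Phi : 'M[R[i]]_(3, N) =>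
  injective_mod_phase (intensity Phi)).
Proof.
set p := certificate (widen_ord leN) re_vars im_vars.
(* The open set is the complement of the hypersurface [p = 0]. *)
exists (~` common_zeros [:: p])%classic; split.
- by exists [:: p]; rewrite setCK.
- exists (row_mx (mxvec (table_mx N (witness_re R))) (mxvec (table_mx N (witness_im R)))).
  move=> /(_ p (mem_head _ _)) /eqP; rewrite certificate_meval.
  by rewrite (negPf (witness_certificate R leN)).
- move=> Phi pPhi; apply: injective_of_kernel => S kerS S0.
  apply: (@certificate_sound _ _ (widen_ord leN) (map_mx (@complex.Re R) Phi)
    (map_mx (@complex.Im R) Phi)) => // [|k]; last first.
    by rewrite -(kerS (widen_ord leN k)) /outer !map_col.
  apply/eqP => c0; apply: pPhi => q; rewrite inE => /eqP ->.
  by rewrite certificate_meval c0.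
Qed.
End Generic.

End PhaseRetrieval.

Theorem theorem12 (R : realType) (M N : nat) (hM : M = 3) (hN : (0 < N)%N) :
  ((N < 4 * M - 4)%N ->
     forall Phi : 'M[R[i]]_(M, N), ~ injective_mod_phase (intensity Phi)) /\
  ((4 * M - 4 <= N)%N ->
     generically (fun Phi : 'M[R[i]]_(M, N) =>
       injective_mod_phase (intensity Phi))).
Proof.
subst M; split=> [ltN8 Phi | leN]; last exact: generic_injectivity.
have [S S0 [h0 kerS]] := singular_in_kernel (fun n => outer (col n Phi)) ltN8.
exact: singular_not_injective S0 h0 kerS.
Qed.
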